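(* Let $\mathcal{R}$ be a commutative ring, $d\ge1$ an integer, and fix $\mathbf{a}=(a_1,\ldots,a_d)\in\mathcal{R}^d$. For $i=0,\ldots,d-1$, let $\big(P_i^{[n]}(\mathbf{a})\big)_{n\ge0}$ be the sequence in $\mathcal{F}(\mathbf{a})$ defined by the initial values $P_i^{[j]}(\mathbf{a})=\delta_{ij}$ for $j=0,\ldots,d-1$. Then these $d$ sequences form a basis (the canonical basis) of the $\mathcal{R}$-module $\mathcal{F}(\mathbf{a})$.
   Context: For $\mathbf{a}=(a_1,\ldots,a_d)\in\mathcal{R}^d$, $\mathcal{F}(\mathbf{a})$ is the $\mathcal{R}$-module (under termwise operations) of sequences $(x_n)_{n\ge0}$ in $\mathcal{R}$ with $x_{n+d}=a_1x_{n+d-1}+\cdots+a_dx_n$ for all $n\ge0$. $\delta_{ij}$ is the Kronecker delta. *)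

(* Defs.v *)
From HB Require Import structures.
From mathcomp Require Import all_boot all_order all_algebra.
From mathcomp Require Import boolp classical_sets functions.

Set Implicit Arguments.
Unset Strict Implicit.
Unset Printing Implicit Defensive.

Import GRing.Theory.
Local Open Scope ring_scope.

(* [basis_of] and [free] of vector.v apply only to vector spaces over a field
   that come with a dimension, hence the following notions for modules. *)
Section ModuleBasis.
Variables (R : pzRingType) (M : lmodType R) (I : finType).

Definition lin_indep (e : I -> M) : Prop :=
  forall c : I -> R, \sum_i c i *: e i = 0 -> forall i, c i = 0.

Definition generates (e : I -> M) : Prop :=
  forall x : M, exists c : I -> R, x = \sum_i c i *: e i.

Definition is_basis (e : I -> M) : Prop := lin_indep e /\ generates e.

End ModuleBasis.

Section LinearRecurrence.
Variables (R : comPzRingType) (d : nat) (a : 'rV[R]_d).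

(* The coefficient a_k (1 <= k <= d) is the entry of index k - 1 of [a].
   The subtraction is never truncated, since k < d. *)
Definition linrec_rel (x : nat -> R) : Prop :=
  forall n : nat, x (n + d)%N = \sum_(k < d) a ord0 k * x (n + d - k.+1)%N.

(* [R^o] is [R] seen as a module over itself; it gives [nat -> R^o] its
   termwise module structure. *)
Definition linrec_pred : {pred (nat -> R^o)} := fun x => `[< linrec_rel x >].

Lemma linrec_predP x : reflect (linrec_rel x) (x \in linrec_pred).
Proof. exact: asboolP. Qed.

Lemma linrec_submod_closed : submod_closed linrec_pred.
Proof.
split=> [|c x y /linrec_predP hx /linrec_predP hy]; apply/linrec_predP => n.
  by rewrite big1 // => k _; rewrite mulr0.
rewrite fctE /= scalrfctE hx hy scaler_sumr -big_split /=.
by apply: eq_bigr => k _; rewrite mulrDr; congr (_ + _); exact: mulrCA.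
Qed.

HB.instance Definition _ :=
  GRing.isSubmodClosed.Build R (nat -> R^o) linrec_pred linrec_submod_closed.

Record linrec_seq := LinrecSeq {
  linrec_fun :> nat -> R^o;
  linrec_funP : linrec_fun \in linrec_pred }.

HB.instance Definition _ := [isSub for linrec_fun].
HB.instance Definition _ := [Choice of linrec_seq by <:].
HB.instance Definition _ := [SubChoice_isSubLmodule of linrec_seq by <:].

End LinearRecurrence.

(* Main.v *)
Require Import Defs.
From HB Require Import structures.
From mathcomp Require Import all_boot all_order all_algebra.
From mathcomp Require Import boolp classical_sets functions.

Set Implicit Arguments.
Unset Strict Implicit.
Unset Printing Implicit Defensive.

Import GRing.Theory.
Local Open Scope ring_scope.

(* A sequence of the module is determined by its first d values, and these may
   be prescribed freely; so taking the first d values identifies the module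
   with R^d, and the sequences P_i correspond to the standard basis. *)

Section InitialValues.
Variables (R : comPzRingType) (d : nat) (a : 'rV[R]_d).

Lemma linrec_seq_eq (x y : linrec_seq a) :
  (forall j : 'I_d, x j = y j) -> x = y.
Proof.
move=> xy; apply: val_inj; apply: funext; elim/ltn_ind => n IHn.
have [nd|dn] := ltnP n d; first exact: (xy (Ordinal nd)).
(* For [d <= n], the relation at [n - d] expresses [x n] and [y n] by the same formula in terms of
   smaller index. *)
have /linrec_predP/(_ (n - d)%N) := linrec_funP x.
have /linrec_predP/(_ (n - d)%N) := linrec_funP y.
rewrite subnK //= => -> ->; apply: eq_bigr => k _; rewrite [linrec_fun _ _]IHn //.
by rewrite ltn_subrL /= (leq_trans _ dn) // (leq_ltn_trans _ (ltn_ord k)).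
Qed.

(* The recursion carries the list of the first n values, because the step
   refers to the d preceding ones. *)
Fixpoint linrec_prefix (v : nat -> R) (n : nat) : seq R :=
  if n is m.+1 then
    let s := linrec_prefix v m in
    rcons s (if (m < d)%N then v m
             else \sum_(k < d) a ord0 k * s`_(m - k.+1))
  else [::].

Definition linrec_ext (v : nat -> R) (n : nat) : R :=
  (linrec_prefix v n.+1)`_n.

Lemma size_linrec_prefix v n : size (linrec_prefix v n) = n.
Proof. by elim: n => //= n IHn; rewrite size_rcons IHn. Qed.

(** The prefixes are nested, since each step only appends at the end; so an entry can be read off
    any prefix that is long enough. *)
Lemma nth_linrec_prefix v n i :
  (i < n)%N -> (linrec_prefix v n)`_i = linrec_ext v i.
Proof.
elim: n => // n IHn; rewrite ltnS leq_eqVlt => /predU1P[->//|lt_in] /=.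
by rewrite nth_rcons size_linrec_prefix lt_in IHn.
Qed.

Lemma linrec_extE v n :
  linrec_ext v n = if (n < d)%N then v n
                   else \sum_(k < d) a ord0 k * linrec_ext v (n - k.+1).
Proof.
rewrite {1}/linrec_ext /= nth_rcons size_linrec_prefix ltnn eqxx.
(* As [k < d <= n], the index [n - k.+1] falls inside the prefix of length [n], so the default value
   of [nth] is never read. *)
case: ltnP => // dn; apply: eq_bigr => k _; rewrite nth_linrec_prefix //.
by rewrite ltn_subrL /= (leq_trans _ dn) // (leq_ltn_trans _ (ltn_ord k)).
Qed.

Lemma linrec_ext_rel v : linrec_rel a (linrec_ext v).
Proof. by move=> n; rewrite linrec_extE ltnNge leq_addl. Qed.

Lemma linrec_seq_ex (v : nat -> R) :
  exists p : linrec_seq a, forall j : 'I_d, p j = v j.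
Proof.
have vP : linrec_ext v \in linrec_pred a by apply/linrec_predP/linrec_ext_rel.
by exists (LinrecSeq vP) => j; rewrite /= linrec_extE ltn_ord.
Qed.

(** Evaluation at [n] is linear because the module operations are termwise. *)
Lemma linrec_seq_sumE (I : finType) (c : I -> R) (P : I -> linrec_seq a) n :
  (\sum_i c i *: P i) n = \sum_i c i * P i n.
Proof. by apply: (big_rec2 (fun p s => linrec_fun p n = s)) => // i p _ _ <-. Qed.

End InitialValues.

Theorem proposition3p4 (R : comPzRingType) (d : nat) (d_ge1 : (1 <= d)%N)
    (a : 'rV[R]_d) :
  (forall i : 'I_d,
     exists! p : linrec_seq a, forall j : 'I_d, p j = (i == j)%:R :> R) /\
  (forall P : 'I_d -> linrec_seq a,
     (forall i j : 'I_d, P i j = (i == j)%:R :> R) -> is_basis P).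
Proof.
split=> [i|P PE].
  have [p pE] := linrec_seq_ex a (fun j => (i == j :> nat)%:R).
  exists p; split=> [j|q qE]; first exact: pE.
  by apply: linrec_seq_eq => j; rewrite pE qE.
(* The coefficients of a combination are its initial values: this gives independence at once, and
   dictates the coefficients for generation. *)
have sumE (c : 'I_d -> R) (j : 'I_d) : (\sum_i c i *: P i) j = c j.
  rewrite linrec_seq_sumE (bigD1 j) //= PE eqxx mulr1 big1 ?addr0 // => i.
  by rewrite PE => /negPf->; rewrite mulr0.
split=> [c c0 i|x]; first by rewrite -sumE c0.
by exists (fun i : 'I_d => linrec_fun x i); apply: linrec_seq_eq => j; rewrite sumE.
Qed.
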